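(* Let $F$ be a field of characteristic $p\neq 3$ (possibly $p=0$), let $L/F$ be a field extension of degree $3$, and let $y$ be a primitive element of $L/F$ with minimal polynomial $T(X)=X^3-3X-a$, where $a\in F$. Then $L/F$ is purely cubic if, and only if, the polynomial $S(X)=X^2+aX+1$ has a root in $F$. Let $c\in\overline{F}$ be a root of $S(X)$. Then $F(c)$ is the purely cubic closure of $L/F$; more precisely, $u=\frac{cy-1}{y-c}$ is a purely cubic generator of $L(c)/F(c)$ with $u^3=c$ if, and only if, $y=\frac{cu-1}{u-c}$ is a generator of $L/F$ with minimal polynomial $T(X)$.
   Context: $\overline{F}$ denotes an algebraic closure of $F$. For $p\neq 3$, a cubic extension $L/F$ is called purely cubic if it has a generator (a purely cubic generator) whose minimal polynomial over $F$ is of the form $X^3-b$ with $b\in F$; otherwise it is called impurely cubic. The purely cubic closure of a cubic extension $L/F$ is the smallest extension $F'$ of $F$ such that $LF'/F'$ is purely cubic. *)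

(* Defs.v *)
From HB Require Import structures.
From mathcomp Require Import all_boot all_order all_algebra all_field.
From mathcomp Require Import boolp classical_sets.
Set Implicit Arguments.
Unset Strict Implicit.
Unset Printing Implicit Defensive.
Import GRing.Theory.
Local Open Scope classical_set_scope.
Local Open Scope ring_scope.

Definition polyT (F : fieldType) (a : F) : {poly F} :=
  'X^3 - 3%:R *: 'X - a%:P.

Definition polyS (F : fieldType) (a : F) : {poly F} :=
  'X^2 + a *: 'X + 1.

Definition has_generator_minpoly (F : fieldType) (L : fieldExtType F)
    (p : {poly F}) (y : L) : Prop :=
  <<1; y>>%VS = {:L}%VS /\ minPoly 1 y = map_poly (in_alg L) p.

Definition purely_cubic_generator (F : fieldType) (L : fieldExtType F)
    (u : L) : Prop :=
  exists b : F, has_generator_minpoly ('X^3 - b%:P) u.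

Definition purely_cubic (F : fieldType) (L : fieldExtType F) : Prop :=
  \dim {:L} = 3%N /\ exists u : L, purely_cubic_generator u.

(* Intermediate fields of an algebraic closure may have infinite degree over
   the base field, so they are represented as sets rather than as {subfield}. *)
Definition is_subfield (E : fieldType) (A : set E) : Prop :=
  divring_closed (mem A).

Definition field_generated (E : fieldType) (X : set E) : set E :=
  smallest (@is_subfield E) X.

Definition adjoin (E : fieldType) (A : set E) (c : E) : set E :=
  field_generated (A `|` [set c]).

Definition compositum (E : fieldType) (A B : set E) : set E :=
  field_generated (A `|` B).

(* g identifies the abstract finite extension M/K with the extension B/A of
   subfields of E.  Properties of B/A are those of any such M/K; they do not
   depend on the choice of M, K and g. *)
Definition identifies (E : fieldType) (A B : set E)
    (K : fieldType) (M : fieldExtType K) (g : {rmorphism M -> E}) : Prop :=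
  range (g \o in_alg M) = A /\ range g = B.

Definition purely_cubic_in (E : fieldType) (A B : set E) : Prop :=
  exists (K : fieldType) (M : fieldExtType K) (g : {rmorphism M -> E}),
    identifies A B g /\ purely_cubic M.

Definition purely_cubic_generator_in (E : fieldType) (A B : set E) (u : E)
    : Prop :=
  exists (K : fieldType) (M : fieldExtType K) (g : {rmorphism M -> E}) (v : M),
    [/\ identifies A B g, g v = u & purely_cubic_generator v].

Definition is_purely_cubic_closure (E : fieldType) (A B C : set E) : Prop :=
  [/\ is_subfield C, A `<=` C, purely_cubic_in C (compositum B C) &
      forall C' : set E, is_subfield C' -> A `<=` C' ->
        purely_cubic_in C' (compositum B C') -> C `<=` C'].

(* Main.v *)
Require Import Defs.
From HB Require Import structures.
From mathcomp Require Import all_boot all_order all_algebra all_field.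
From mathcomp Require Import boolp classical_sets.
From mathcomp Require Import ring.
Set Implicit Arguments.
Unset Strict Implicit.
Unset Printing Implicit Defensive.
Import GRing.Theory.
Local Open Scope classical_set_scope.
Local Open Scope ring_scope.

(** If c is a root of S, then a = -(c + 1/c), and the substitution
    u = (c y - 1) / (y - c) gives the identity
    (c y - 1)^3 - c (y - c)^3 = (c^3 - c) T(y): it exchanges T(y) = 0 with
    u^3 = c, and it is inverted by the same formula.  Since c is at most
    quadratic over F, the irreducible cubic T keeps no root in F(c), so L(c)/F(c)
    is again cubic.  Conversely, if M = K(v) with v^3 = b contains a root of T
    outside K, its coordinates in the basis 1, v, v^2 exhibit a root of S in K;
    applied to each K over which L becomes purely cubic, this gives minimality. *)

(** * Subfields of an ambient field, as sets *)

Lemma is_subfieldP (E : fieldType) (A : set E) :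
  is_subfield A <-> [/\ A 1, forall x y, A x -> A y -> A (x - y) &
                       forall x y, A x -> A y -> A (x / y)].
Proof.
split=> [[A1 AB AV]|[A1 AB AV]].
  split=> [|x y Ax Ay|x y Ax Ay]; apply/set_mem => //.
    by apply: AB; apply/mem_set.
  by apply: AV; apply/mem_set.
split=> [|x y /set_mem Ax /set_mem Ay|x y /set_mem Ax /set_mem Ay];
  apply/mem_set => //; [exact: AB | exact: AV].
Qed.

Lemma field_generated_subfield (E : fieldType) (X : set E) :
  is_subfield (field_generated X).
Proof.
apply/is_subfieldP; split=> [B [/is_subfieldP[]] //|x y Ax Ay B BX|x y Ax Ay B BX].
  by have [/is_subfieldP[_ BB _] _] := BX; apply: BB; [exact: Ax|exact: Ay].
by have [/is_subfieldP[_ _ BB] _] := BX; apply: BB; [exact: Ax|exact: Ay].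
Qed.

Lemma sub_field_generated (E : fieldType) (X : set E) :
  X `<=` field_generated X.
Proof. exact: sub_gen_smallest. Qed.

Lemma field_generated_min (E : fieldType) (X B : set E) :
  is_subfield B -> X `<=` B -> field_generated X `<=` B.
Proof. exact: smallest_sub. Qed.

Lemma sub_adjoin (E : fieldType) (A : set E) (z : E) : A `<=` adjoin A z.
Proof. by move=> x Ax; apply: sub_field_generated; left. Qed.

Lemma mem_adjoin (E : fieldType) (A : set E) (z : E) : adjoin A z z.
Proof. by apply: sub_field_generated; right. Qed.

Lemma adjoin_min (E : fieldType) (A B : set E) (z : E) :
  is_subfield B -> A `<=` B -> B z -> adjoin A z `<=` B.
Proof. by move=> sB AB Bz; apply: field_generated_min => // x [/AB|->]. Qed.

Lemma range_subfield (K E : fieldType) (g : {rmorphism K -> E}) :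
  is_subfield (range g).
Proof.
apply/is_subfieldP; split=> [|_ _ [x _ <-] [y _ <-]|_ _ [x _ <-] [y _ <-]].
- by exists 1; rewrite ?rmorph1.
- by exists (x - y); rewrite ?rmorphB.
- by exists (x / y); rewrite ?fmorph_div.
Qed.

(** * Adjoining a root inside an ambient field *)

Lemma subfield_horner (K E : fieldType) (iota : {rmorphism K -> E})
    (A : set E) (z : E) (q : {poly K}) :
  is_subfield A -> range iota `<=` A -> A z -> A (map_poly iota q).[z].
Proof.
move=> /is_subfieldP[A1 AB AV] sA Az.
have A0 : A 0 by rewrite -(subrr 1); apply: AB.
have AN x : A x -> A (- x) by rewrite -[- x]sub0r; apply: AB.
have AD x y : A x -> A y -> A (x + y).
  by move=> Ax Ay; rewrite -[y]opprK; apply: AB => //; apply: AN.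
have AM x y : A x -> A y -> A (x * y).
  (* A product is the quotient of x by 1 / y; the convention [0^-1 = 0] covers y = 0 as well. *)
  move=> Ax Ay; rewrite -[y]invrK; apply: (AV) => //.
  by rewrite -[y^-1]div1r; apply: AV.
elim/poly_ind: q => [|q b IH]; first by rewrite map_poly0 horner0.
rewrite rmorphD rmorphM /= map_polyX map_polyC hornerMXaddC.
by apply: AD; [exact: AM | apply: sA; exists b].
Qed.

(** Meant for [polyS a], which may split over the base: [subFExtend] produces K(z) from any nonzero
    p vanishing at z, here as a bare field with its two embeddings. *)
Lemma root_field (K E : fieldType) (iota : {rmorphism K -> E}) (z : E)
    (p : {poly K}) : p != 0 -> root (map_poly iota p) z ->
  exists (M : fieldType) (i : {rmorphism K -> M}) (g : {rmorphism M -> E}),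
    [/\ forall x, g (i x) = iota x, exists r, g r = z &
        forall x, exists q, g x = (map_poly iota q).[z]].
Proof.
move=> p0 pz; exists (subFExtend iota z p), (inj_subfx iota z p), (subfx_inj).
split=> [x||x].
- by rewrite /= subfx_inj_eval // map_polyC hornerC.
- by exists (subfx_root iota z p); apply: (subfx_inj_root pz p0).
- by have [q ->] := subfxE x; exists q; apply: (subfx_inj_eval pz p0).
Qed.

(** Irreducibility of p makes K(z) a finite extension of known degree. This serves to adjoin a root
    of T over F(c). *)
Lemma irreducible_root_fieldExt (K E : fieldType) (iota : {rmorphism K -> E})
    (z : E) (p : {poly K}) : irreducible_poly p -> root (map_poly iota p) z ->
  exists (M : fieldExtType K) (g : {rmorphism M -> E}),
    [/\ \dim {:M} = (size p).-1, forall x, g (in_alg M x) = iota x,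
        exists r, g r = z & forall x, exists q, g x = (map_poly iota q).[z]].
Proof.
move=> irr_p pz; have p0 := irredp_neq0 irr_p.
exists (SubFieldExtType pz irr_p), (subfx_inj : subFExtend iota z p -> E).
split=> [|x||x].
- by rewrite dimvf.
- exact: (subfx_inj_base pz p0).
- by exists (subfx_root iota z p); apply: (subfx_inj_root pz p0).
- by have [q ->] := subfxE x; exists q; apply: (subfx_inj_eval pz p0).
Qed.

(** * The polynomials T and S, cubic generators, and irreducibility of T *)

Lemma size_cubic (F : fieldType) (a b : F) :
  size ('X^3 + (a *: 'X + b%:P)) = 4%N.
Proof.
rewrite size_polyDl ?size_polyXn // ltnS.
apply: leq_trans (size_polyD _ _) _; rewrite geq_max.
rewrite (leq_trans (size_scale_leq _ _)) ?size_polyX //.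
by rewrite (leq_trans (size_polyC_leq1 _)).
Qed.

Lemma monic_cubic (F : fieldType) (a b : F) :
  'X^3 + (a *: 'X + b%:P) \is monic.
Proof.
rewrite monicE lead_coefE size_cubic !coefD coefXn coefZ coefX coefC /=.
by rewrite mulr0 !addr0.
Qed.

Lemma polyTE (F : fieldType) (a : F) :
  polyT a = 'X^3 + ((- 3%:R) *: 'X + (- a)%:P).
Proof. by rewrite /polyT -addrA scaleNr polyCN. Qed.

Lemma XnsubCE (F : fieldType) (b : F) :
  'X^3 - b%:P = 'X^3 + (0 *: 'X + (- b)%:P).
Proof. by rewrite scale0r add0r polyCN. Qed.

Lemma size_quadratic (F : fieldType) (a b : F) :
  size ('X^2 + (a *: 'X + b%:P)) = 3%N.
Proof.
rewrite size_polyDl ?size_polyXn // ltnS.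
apply: leq_trans (size_polyD _ _) _; rewrite geq_max.
rewrite (leq_trans (size_scale_leq _ _)) ?size_polyX //.
by rewrite (leq_trans (size_polyC_leq1 _)).
Qed.

Lemma horner_map_quadratic (F E : fieldType) (iota : {rmorphism F -> E}) s t x :
  (map_poly iota ('X^2 + (s *: 'X + t%:P))).[x]
    = x ^+ 2 + (iota s * x + iota t).
Proof.
rewrite 2!rmorphD /= map_polyZ map_polyXn map_polyX map_polyC.
by rewrite !hornerE.
Qed.

Lemma size_polyS (F : fieldType) (a : F) : size (polyS a) = 3%N.
Proof. by rewrite /polyS -addrA size_quadratic. Qed.

Lemma root_map_polyT (F E : fieldType) (iota : {rmorphism F -> E}) a x :
  root (map_poly iota (polyT a)) x = (x ^+ 3 - 3%:R * x - iota a == 0).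
Proof.
rewrite rootE /polyT !rmorphB /= map_polyZ map_polyXn map_polyX map_polyC /=.
by rewrite rmorph_nat !hornerE.
Qed.

Lemma root_map_polyS (F E : fieldType) (iota : {rmorphism F -> E}) a x :
  root (map_poly iota (polyS a)) x = (x ^+ 2 + iota a * x + 1 == 0).
Proof.
rewrite rootE /polyS !rmorphD /= map_polyZ map_polyXn map_polyX rmorph1.
by rewrite !hornerE.
Qed.

(** Since 3 is prime, z has degree 1 or 3, and lying outside the base field forces 3. Its minimal
    polynomial then divides a monic polynomial of the same degree, hence equals it. *)
Lemma cubic_generator (F : fieldType) (L : fieldExtType F) (p : {poly F})
    (z : L) : \dim {:L} = 3%N -> p \is monic -> size p = 4%N ->
  z \notin 1%VS -> root (map_poly (in_alg L) p) z ->
  has_generator_minpoly p z.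
Proof.
move=> dimL mp sp zN pz.
have dimz : \dim <<1; z>> = adjoin_degree 1%AS z.
  by rewrite dim_Fadjoin dimv1 muln1.
have degz : adjoin_degree 1%AS z = 3%N.
  have : (adjoin_degree 1%AS z %| 3)%N.
    by rewrite -dimz -dimL; apply/field_dimS/subvf.
  rewrite dvdn_divisors // !inE adjoin_deg_eq1 (negbTE zN).
  by move/eqP.
have zgen : <<1; z>>%VS = {:L}%VS.
  by apply/eqP; rewrite eqEdim subvf dimz degz dimL.
split=> //; apply/eqP; rewrite -eqp_monic ?monic_minPoly ?map_monic //.
rewrite -dvdp_size_eqp ?size_minPoly ?degz ?size_map_poly ?sp //.
apply: minPoly_dvdp => //; apply/polyOver1P; by exists p.
Qed.

Lemma polyT_irreducible (F : fieldType) (L : fieldExtType F) (a : F) (y : L) :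
  has_generator_minpoly (polyT a) y -> irreducible_poly (polyT a).
Proof.
move=> [_ minT]; split; first by rewrite polyTE size_cubic.
move=> q q1 qT.
have : map_poly (in_alg L) q %= minPoly 1 y \/ map_poly (in_alg L) q %= 1.
  apply/orP; apply: minPoly_irr; last by rewrite minT dvdp_map.
  by apply/polyOver1P; exists q.
case; first by rewrite minT eqp_map.
by move/eqp_size; rewrite size_map_poly size_poly1 => /eqP; rewrite (negbTE q1).
Qed.

Lemma generator_root_polyT (F : fieldType) (L : fieldExtType F) (a : F) (y : L) :
  has_generator_minpoly (polyT a) y -> root (map_poly (in_alg L) (polyT a)) y.
Proof. by move=> [_ <-]; apply: root_minPoly. Qed.

(** Every element of F(c) is killed by a polynomial of degree 2 over F, whereas an irreducible T has
    least degree among the nonzero polynomials vanishing at one of its roots. The argument is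
    uniform in c, whether S splits over F or not. *)
Lemma quadratic_not_root_polyT (F E : fieldType) (iota : {rmorphism F -> E})
    (a : F) (c : E) (q : {poly F}) : irreducible_poly (polyT a) ->
  root (map_poly iota (polyS a)) c ->
  ~~ root (map_poly iota (polyT a)) (map_poly iota q).[c].
Proof.
move=> irrT Sc; apply/negP => Tx.
have S0 : polyS a != 0 by rewrite -size_poly_gt0 size_polyS.
have sr : (size (q %% polyS a)%R < 3)%N by rewrite -(size_polyS a) ltn_modp.
have qr : (map_poly iota q).[c] = (map_poly iota (q %% polyS a)).[c].
  rewrite {1}(divp_eq q (polyS a)) rmorphD rmorphM hornerD hornerM /=.
  by rewrite (rootP Sc) mulr0 add0r.
move: Tx; rewrite qr; move: (q %% _) sr => r sr Tx.
set al := r`_0; set be := r`_1.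
have rE : (map_poly iota r).[c] = iota al + iota be * c.
  rewrite (@horner_coef_wide _ 2) ?size_map_poly //.
  by rewrite !big_ord_recl big_ord0 !coef_map /= expr0 expr1 mulr1 addr0.
have T0 := irredp_neq0 irrT.
have /(subfx_irreducibleP Tx T0) minT := irrT.
(* The characteristic polynomial of al + be X acting on F[X]/(S): the roots of S have sum -a and
   product 1, so the trace is 2 al - a be and the norm is al^2 - a al be + be^2. *)
have := minT ('X^2 + ((a * be - al *+ 2) *: 'X
                     + (al ^+ 2 - a * al * be + be ^+ 2)%:P)).
rewrite polyTE size_cubic size_quadratic => min_le.
suff : (4 <= 3)%N by []; apply: min_le; last first.
  by rewrite -size_poly_gt0 size_quadratic.
move: Sc; rewrite root_map_polyS rE => /eqP Sc; apply/eqP.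
rewrite horner_map_quadratic !(rmorphD, rmorphN, rmorphM, rmorphXn, rmorphMn) /=.
transitivity (iota be ^+ 2 * (c ^+ 2 + iota a * c + 1)); first by ring.
by rewrite Sc mulr0.
Qed.

Lemma irreducible_polyT_no_root (F : fieldType) (a x : F) :
  irreducible_poly (polyT a) -> x ^+ 3 - 3%:R * x - a != 0.
Proof.
move=> irrT; apply/negP => Tx.
have Tx' : root (map_poly idfun (polyT a)) x by rewrite root_map_polyT.
have T0 := irredp_neq0 irrT.
have /(subfx_irreducibleP Tx' T0) /(_ ('X - x%:P)) := irrT.
rewrite polyTE size_cubic size_XsubC map_poly_id // root_XsubC eqxx.
by move/(_ isT); rewrite polyXsubC_eq0; move/(_ isT).
Qed.

(** * The Möbius substitution and the roots of S *)

Lemma mobius_cubic (E : fieldType) (a c x : E) :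
  c ^+ 2 + a * c + 1 = 0 ->
  (c * x - 1) ^+ 3 - c * (x - c) ^+ 3
    = (c ^+ 3 - c) * (x ^+ 3 - 3%:R * x - a).
Proof.
move=> Sc.
(* This eliminates a: since S(c) = 0 gives a c = -(c^2 + 1), the term -(c^3 - c) a becomes (c^2 -
   1)(c^2 + 1) = c^4 - 1. *)
have -> : (c ^+ 3 - c) * (x ^+ 3 - 3%:R * x - a)
   = (c ^+ 3 - c) * (x ^+ 3 - 3%:R * x) + c ^+ 4 - 1
     - (c ^+ 2 - 1) * (c ^+ 2 + a * c + 1) by ring.
by rewrite Sc; ring.
Qed.

(* Writing y = al + be v + ga v^2, the relation T(y) = 0 forces al = 0 and
   be ga b = 1, and then - be^3 b and - ga^3 b^2 are the two roots of S. *)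
Lemma pure_root_polyS (K : fieldType) (M : fieldExtType K) (a : K) (y : M) :
  3%:R != 0 :> K -> purely_cubic M -> y \notin 1%VS ->
  root (map_poly (in_alg M) (polyT a)) y -> exists x : K, root (polyS a) x.
Proof.
move=> n3 [_ [v [b [gen minv]]]] yN.
(* [phi] is an opaque copy of [in_alg M], which simplification cannot unfold into scalar multiples
   of 1. *)
have [phi phiE] : exists phi : {rmorphism K -> M}, forall x, in_alg M x = phi x.
  by exists (in_alg M).
rewrite !(eq_map_poly phiE) in minv *; rewrite root_map_polyT => /eqP Ty.
have indep (p : {poly K}) : (size p <= 3)%N -> (map_poly phi p).[v] = 0 -> p = 0.
  move=> sp pv; apply/eqP; apply: contraLR sp => p0; rewrite -ltnNge.
  have /dvdp_leq : minPoly 1 v %| map_poly phi p.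
    by apply: minPoly_dvdp; [apply/polyOver1P; exists p; apply/esym/eq_map_poly|apply/rootP].
  by rewrite map_poly_eq0 minv !size_map_poly XnsubCE size_cubic => ->.
have v3 : v ^+ 3 = phi b.
  have := minPolyxx 1 v; rewrite minv rmorphB /= map_polyXn map_polyC !hornerE.
  by move/eqP; rewrite subr_eq0 => /eqP.
pose ev (s t r : K) : M := phi s + phi t * v + phi r * v ^+ 2.
have ev0 s t r : ev s t r = 0 -> [/\ s = 0, t = 0 & r = 0].
  move=> e; have := indep (Poly [:: s; t; r]) (size_Poly _).
  have -> : (map_poly phi (Poly [:: s; t; r])).[v] = ev s t r.
    rewrite /= !cons_poly_def mul0r add0r !(rmorphD, rmorphM) /= !map_polyC map_polyX.
    by rewrite !hornerE /ev; ring.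
  by move=> /(_ e) /polyP p0; split; [have := p0 0%N|have := p0 1%N|have := p0 2%N];
    rewrite coef_Poly coef0.
have [al [be [ga yE]]] : exists al be ga, y = ev al be ga.
  have /Fadjoin1_polyP[p yp] : y \in <<1; v>>%VS by rewrite gen memvf.
  pose m := 'X^3 - b%:P : {poly K}.
  have sm : size m = 4%N by rewrite /m XnsubCE size_cubic.
  have sr : (size (p %% m)%R <= 3)%N.
    by rewrite -ltnS -sm ltn_modp -size_poly_gt0 sm.
  have mv : (map_poly phi m).[v] = 0 by rewrite /m -minv minPolyxx.
  exists (p %% m)`_0, (p %% m)`_1, (p %% m)`_2; rewrite yp.
  rewrite (eq_map_poly phiE) {1}(divp_eq p m) rmorphD rmorphM /= hornerD hornerM mv.
  rewrite mulr0 add0r (@horner_coef_wide _ 3) ?size_map_poly //.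
  rewrite !big_ord_recl big_ord0 !coef_map /= expr0 expr1 mulr1 addr0 /ev addrA //.
(* The coordinates of T(y) on 1, v, v^2, after reduction by v^3 = b. The factor 3 in the last two is
   cancelled below, as 3 is invertible in K. *)
have [e0 e1 e2] : [/\ al ^+ 3 + be ^+ 3 * b + ga ^+ 3 * b ^+ 2
                       + 6%:R * al * be * ga * b - 3%:R * al - a = 0,
     3%:R * (al ^+ 2 * be + al * ga ^+ 2 * b + be ^+ 2 * ga * b - be) = 0 &
     3%:R * (al ^+ 2 * ga + al * be ^+ 2 + be * ga ^+ 2 * b - ga) = 0].
  apply: ev0; rewrite -[RHS]Ty yE /ev.
  rewrite !(rmorphD, rmorphB, rmorphN, rmorphM, rmorphXn, rmorph_nat) /=.
  by rewrite -v3; ring.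
move/eqP: e1; rewrite mulf_eq0 (negbTE n3) /= => /eqP e1.
move/eqP: e2; rewrite mulf_eq0 (negbTE n3) /= => /eqP e2.
have bega : (be != 0) || (ga != 0).
  rewrite -negb_and; apply: contra yN => /andP[/eqP be0 /eqP ga0].
  rewrite yE /ev be0 ga0 !rmorph0 !mul0r !addr0.
  apply/vlineP; exists al; apply/esym/phiE.
(* If b = t^3, then v is a root of X - t or of X^2 + t X + t^2, against the independence of 1, v,
   v^2. *)
have noncube t : b != t ^+ 3.
  apply/eqP => bt.
  have : (v - phi t) * (v ^+ 2 + phi t * v + phi (t ^+ 2)) = 0.
    rewrite rmorphXn.
    have -> : (v - phi t) * (v ^+ 2 + phi t * v + phi t ^+ 2) = v ^+ 3 - phi t ^+ 3.
      by ring.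
    by rewrite v3 bt rmorphXn subrr.
  move/eqP; rewrite mulf_eq0 => /orP[] /eqP e.
    have [] := ev0 (- t) 1 0; last by move=> _ /eqP; rewrite oner_eq0.
    by rewrite -[RHS]e /ev rmorphN rmorph1 rmorph0; ring.
  have [] := ev0 (t ^+ 2) t 1; last by move=> _ _ /eqP; rewrite oner_eq0.
  by rewrite -[RHS]e /ev rmorphXn rmorph1; ring.
have al0 : al = 0.
  (* The combination of ga times the first relation minus be times the second factors. If the other
     factor vanishes, either be = ga = 0 or b is the cube of be / ga, and both are excluded. *)
  have : al * (ga ^+ 3 * b - be ^+ 3) = 0.
    transitivity (ga * (al ^+ 2 * be + al * ga ^+ 2 * b + be ^+ 2 * ga * b - be)
      - be * (al ^+ 2 * ga + al * be ^+ 2 + be * ga ^+ 2 * b - ga)); first by ring.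
    by rewrite e1 e2 !mulr0 subrr.
  move/eqP; rewrite mulf_eq0 => /orP[/eqP //|]; rewrite subr_eq0 => /eqP gb.
  have [ga0|ga0] := eqVneq ga 0.
    move: gb bega; rewrite ga0 expr0n /= mul0r eqxx orbF => /esym/eqP.
    by rewrite expf_eq0 /= => ->.
  have := noncube (be / ga); rewrite expr_div_n -gb [ga ^+ 3 * b]mulrC mulfK ?eqxx //.
  by rewrite expf_eq0.
have bgb : be * ga * b = 1.
  move: e1 e2; rewrite al0 => e1 e2; apply/eqP; rewrite -subr_eq0.
  case/orP: bega => nz; rewrite -(mulrI_eq0 _ (mulfI nz)); apply/eqP.
    by rewrite -[RHS]e1; ring.
  by rewrite -[RHS]e2; ring.
exists (- (be ^+ 3 * b)).
have -> : polyS a = map_poly idfun (polyS a) by rewrite map_poly_id.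
rewrite root_map_polyS /=; apply/eqP.
have -> : a = be ^+ 3 * b + ga ^+ 3 * b ^+ 2.
  by apply/esym/eqP; rewrite -subr_eq0 -[X in _ == X]e0 al0; apply/eqP; ring.
transitivity (1 - (be * ga * b) ^+ 3); first by ring.
by rewrite bgb expr1n subrr.
Qed.

Lemma polyT_root_notin_base (F : fieldType) (L : fieldExtType F) (a : F)
    (z : L) : irreducible_poly (polyT a) ->
  root (map_poly (in_alg L) (polyT a)) z -> z \notin 1%VS.
Proof.
move=> irrT Tz; apply/negP => /vlineP[s zs]; move: Tz.
rewrite zs -[s%:A]/(in_alg L s) fmorph_root => Ts.
have := irreducible_polyT_no_root s irrT.
have -> : s ^+ 3 - 3%:R * s - a = (polyT a).[s] by rewrite /polyT !hornerE.
by rewrite (rootP Ts) eqxx.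
Qed.

(** Nondegeneracy of the substitution. The constant term of S gives c != 0; the rest follows from
    T(c) != 0, the case q = X of [quadratic_not_root_polyT], since c T(c) = (c^2 - 1)^2 - S(c). *)
Lemma mobius_facts (F E : fieldType) (iota : {rmorphism F -> E}) (a : F)
    (c : E) : irreducible_poly (polyT a) -> root (map_poly iota (polyS a)) c ->
  [/\ c != 0, c ^+ 3 - c != 0, c ^+ 2 - 1 != 0 &
      forall w, root (map_poly iota (polyT a)) w -> w - c != 0].
Proof.
move=> irrT Sc; have /negP Tc := quadratic_not_root_polyT 'X irrT Sc.
have := Sc; rewrite map_polyX hornerX root_map_polyS in Tc * => /eqP Sc0.
have c0 : c != 0.
  by apply: contra_eq_neq Sc0 => ->; rewrite expr0n mulr0 !add0r oner_eq0.
have c21 : c ^+ 2 - 1 != 0.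
  apply/eqP => c21; apply: Tc; rewrite root_map_polyT.
  rewrite -(mulrI_eq0 _ (mulfI c0)); apply/eqP.
  transitivity ((c ^+ 2 - 1) ^+ 2 - (c ^+ 2 + iota a * c + 1)); first by ring.
  by rewrite c21 Sc0 expr0n subrr.
split=> // [|w Tw].
  have -> : c ^+ 3 - c = c * (c ^+ 2 - 1) by ring.
  by rewrite mulf_neq0.
by apply/negP; rewrite subr_eq0 => /eqP wc; apply: Tc; rewrite -wc.
Qed.

(** The matrix with rows (c, -1) and (1, -c) has trace 0, so its Möbius map is an involution where
    the determinant 1 - c^2 is nonzero. Concretely, the relation reads (u - c)(w - c) = c^2 - 1,
    which is symmetric in u and w. *)
Lemma mobius_swap (E : fieldType) (c w u : E) :
  c ^+ 2 - 1 != 0 -> w - c != 0 -> u = (c * w - 1) / (w - c) ->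
  u - c != 0 /\ w = (c * u - 1) / (u - c).
Proof.
move=> c2 wc uE.
have uw : u * (w - c) = c * w - 1 by rewrite uE divfK.
have uc : (u - c) * (w - c) = c ^+ 2 - 1 by rewrite mulrBl uw; ring.
have uc0 : u - c != 0 by apply: contraNneq c2 => e; rewrite -uc e mul0r.
split=> //; apply: (mulIf uc0); rewrite divfK //.
transitivity (u * (w - c) + c * u - c * w); first by ring.
by rewrite uw; ring.
Qed.

Lemma mobius_cube (F E : fieldType) (iota : {rmorphism F -> E}) (a : F)
    (c w : E) : irreducible_poly (polyT a) ->
  root (map_poly iota (polyS a)) c -> w - c != 0 ->
  (((c * w - 1) / (w - c)) ^+ 3 == c) = root (map_poly iota (polyT a)) w.
Proof.
move=> irrT Sc wc; have [_ c3 _ _] := mobius_facts irrT Sc.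
rewrite root_map_polyT -[RHS](mulrI_eq0 _ (mulfI c3)).
move: Sc; rewrite root_map_polyS => /eqP Sc.
rewrite -(mobius_cubic _ Sc) subr_eq0 expr_div_n.
by rewrite -[RHS](inj_eq (divIf (expf_neq0 3 wc))) mulfK // expf_neq0.
Qed.

(** * Purely cubic extensions between subfields of an ambient field *)

Lemma purely_cubic_generator_dim (K : fieldType) (M : fieldExtType K) (v : M) :
  purely_cubic_generator v -> \dim {:M} = 3%N.
Proof.
move=> [b [gen minv]]; rewrite -gen dim_Fadjoin dimv1 muln1.
by apply/succn_inj; rewrite -size_minPoly minv size_map_poly XnsubCE size_cubic.
Qed.

Lemma purely_cubic_generator_in_sub (E : fieldType) (A B : set E) (u : E) :
  purely_cubic_generator_in A B u -> purely_cubic_in A B.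
Proof.
move=> [K [M [g [v [idg _ pv]]]]]; exists K, M, g; split=> //.
by split; [exact: purely_cubic_generator_dim pv | exists v].
Qed.

Lemma pure_generatorP (K : fieldType) (M : fieldExtType K) (b : K) (v : M) :
  \dim {:M} = 3%N -> v \notin 1%VS -> v ^+ 3 = in_alg M b ->
  has_generator_minpoly ('X^3 - b%:P) v.
Proof.
move=> dimM vN v3.
apply: cubic_generator => //; rewrite ?XnsubCE ?monic_cubic ?size_cubic //.
rewrite -XnsubCE rootE rmorphB /= map_polyXn map_polyC !hornerE.
by rewrite v3 subrr.
Qed.

(** Translates the fields built by [root_field] and [irreducible_root_fieldExt] into the sets
    [adjoin]. *)
Lemma range_root_field (K M E : fieldType) (iota : {rmorphism K -> E})
    (i : {rmorphism K -> M}) (g : {rmorphism M -> E}) (z : E) :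
  (forall x, g (i x) = iota x) -> (exists r, g r = z) ->
  (forall x, exists q, g x = (map_poly iota q).[z]) ->
  range g = adjoin (range iota) z.
Proof.
move=> gi [r gr] gq; apply/seteqP; split.
  move=> _ [x _ <-]; have [q ->] := gq x.
  apply: (@subfield_horner _ _ _ (adjoin _ _)); first exact: field_generated_subfield.
    exact: sub_adjoin.
  exact: mem_adjoin.
apply: adjoin_min; [exact: range_subfield | | by exists r].
by move=> _ [x _ <-]; exists (i x).
Qed.

(** The model is a tower: K stands for F(c), and M = K(w) is cubic because T stays irreducible over
    K. The Möbius image of w has cube c and lies outside K. *)
Lemma purely_cubic_generator_adjoin (F E : fieldType)
    (iota : {rmorphism F -> E}) (a : F) (c w : E) :
  irreducible_poly (polyT a) -> root (map_poly iota (polyS a)) c ->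
  root (map_poly iota (polyT a)) w ->
  purely_cubic_generator_in (adjoin (range iota) c)
    (adjoin (adjoin (range iota) c) w) ((c * w - 1) / (w - c)).
Proof.
move=> irrT Sc Tw.
have [_ _ c2 /(_ _ Tw) wc] := mobius_facts irrT Sc.
have S0 : polyS a != 0 by rewrite -size_poly_gt0 size_polyS.
have [K [i [k [ki [c1 kc1] kq]]]] := root_field S0 Sc.
have rk := range_root_field ki (ex_intro _ _ kc1) kq.
have kiT : map_poly iota (polyT a) = map_poly k (polyT (i a)).
  rewrite /polyT !rmorphB /= !map_polyZ /= !map_polyXn !map_polyX !map_polyC /=.
  by rewrite !rmorph_nat ki.
have irrTK : irreducible_poly (polyT (i a)).
  (* A cubic without roots is irreducible, and elements of K are polynomials in c, none of which is
     a root of T. *)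
  apply: cubic_irreducible; first by rewrite polyTE size_cubic.
  move=> x; rewrite -(fmorph_root k) -kiT; have [q ->] := kq x.
  exact: quadratic_not_root_polyT.
have TKw : root (map_poly k (polyT (i a))) w by rewrite -kiT.
have [M [g [dimM gk [w1 gw1] gq]]] := irreducible_root_fieldExt irrTK TKw.
have rg := range_root_field (i := in_alg M) gk (ex_intro _ _ gw1) gq.
pose c2M := in_alg M c1.
have gc : g c2M = c by rewrite gk.
exists K, M, g, ((c2M * w1 - 1) / (w1 - c2M)); split.
- split; last by rewrite rg rk.
  rewrite -rk; apply/seteqP; split=> [_ [x _ <-]|_ [x _ <-]].
    by exists x; rewrite //= -gk.
  by exists x => //=; rewrite gk.
- by rewrite fmorph_div !rmorphB rmorphM rmorph1 gc gw1.
exists c1; apply: pure_generatorP; first by rewrite dimM polyTE size_cubic.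
  (* If the Möbius image of w came from K, then so would w by the inverse substitution, and T would
     have a root in F(c). *)
  have [_ wE] := mobius_swap c2 wc erefl.
  apply/negP => /vlineP[s us].
  have gs : (c * w - 1) / (w - c) = k s.
    rewrite -gk -[in_alg M s]us.
    by rewrite fmorph_div !rmorphB rmorphM rmorph1 gc gw1.
  have [q kE] := kq ((c1 * s - 1) / (s - c1)).
  have kw : k ((c1 * s - 1) / (s - c1)) = w.
    by rewrite fmorph_div !rmorphB rmorphM rmorph1 kc1 -gs -wE.
  by have := quadratic_not_root_polyT q irrT Sc; rewrite -kE kw Tw.
apply: (fmorph_inj g); rewrite rmorphXn gc fmorph_div !rmorphB rmorphM rmorph1 gc gw1.
by apply/eqP; rewrite (mobius_cube irrT Sc wc).
Qed.

Lemma adjoin_range_generator (F : fieldType) (L : fieldExtType F) (E : fieldType)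
    (j : {rmorphism L -> E}) (c : E) (z : L) : <<1; z>>%VS = {:L}%VS ->
  adjoin (adjoin (range (j \o in_alg L)) c) (j z) = adjoin (range j) c.
Proof.
move=> gen; apply/seteqP; split.
  apply: adjoin_min; first exact: field_generated_subfield.
    apply: adjoin_min; first exact: field_generated_subfield.
      by move=> _ [x _ <-]; apply: sub_adjoin; exists (in_alg L x).
    exact: mem_adjoin.
  by apply: sub_adjoin; exists z.
apply: adjoin_min; first exact: field_generated_subfield.
  move=> _ [x _ <-].
  have /Fadjoin1_polyP[q ->] : x \in <<1; z>>%VS by rewrite gen memvf.
  rewrite -horner_map -map_poly_comp.
  apply: (@subfield_horner _ _ (j \o in_alg L) (adjoin _ _)).
  - exact: field_generated_subfield.
  - by apply: subset_trans; apply: sub_adjoin.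
  - exact: mem_adjoin.
by apply: sub_adjoin; apply: mem_adjoin.
Qed.

Lemma compositum_adjoin (E : fieldType) (A B : set E) (c : E) :
  A `<=` B -> compositum B (adjoin A c) = adjoin B c.
Proof.
move=> AB; apply/seteqP; split.
  apply: field_generated_min; first exact: field_generated_subfield.
  move=> x [Bx|]; first exact: sub_adjoin.
  apply: adjoin_min; first exact: field_generated_subfield.
    by apply: subset_trans AB _; apply: sub_adjoin.
  exact: mem_adjoin.
apply: adjoin_min; first exact: field_generated_subfield.
  by move=> x Bx; apply: sub_field_generated; left.
by apply: sub_field_generated; right; apply: mem_adjoin.
Qed.

(** Minimality of F(c). In a model M/K of LC/C the element y lies outside K, so [pure_root_polyS]
    puts one root of S in C; the two roots have sum -a, hence C contains both. *)
Lemma pure_compositum_root (F : fieldType) (L : fieldExtType F) (E : fieldType)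
    (j : {rmorphism L -> E}) (a : F) (y : L) (c : E) (C : set E) :
  3%:R != 0 :> F -> has_generator_minpoly (polyT a) y ->
  root (map_poly (j \o in_alg L) (polyS a)) c ->
  is_subfield C -> range (j \o in_alg L) `<=` C ->
  purely_cubic_in C (compositum (range j) C) -> C c.
Proof.
move=> n3 y_gen Sc sC FC [K [M [g [[rK rM] pM]]]].
have [a' _ /= ga] : range (g \o in_alg M) (j (in_alg L a)).
  by rewrite rK; apply: FC; exists a.
have [y' _ gy] : range g (j y).
  by rewrite rM; apply: sub_field_generated; left; exists y.
have Ty : root (map_poly (in_alg M) (polyT a')) y'.
  rewrite root_map_polyT -(inj_eq (fmorph_inj g)) !rmorphB rmorphXn rmorphM.
  rewrite rmorph_nat rmorph0 gy ga -(rmorph_nat j) -rmorphXn -rmorphM -!rmorphB.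
  by have := generator_root_polyT y_gen; rewrite fmorph_eq0 root_map_polyT.
have n3K : 3%:R != 0 :> K.
  rewrite -(inj_eq (fmorph_inj (g \o in_alg M))) rmorph_nat rmorph0.
  by rewrite -(rmorph_nat (j \o in_alg L)) fmorph_eq0.
(* If y were in C, then L, generated by y, would lie in C, the compositum would collapse to C, and M
   would have degree 1 instead of 3. *)
have yN : y' \notin 1%VS.
  apply/negP => /vlineP[s ys].
  have jyC : C (j y) by rewrite -rK -gy ys; exists s.
  have LC : range j `<=` C.
    move=> _ [x _ <-].
    have /Fadjoin1_polyP[q ->] : x \in <<1; y>>%VS by rewrite y_gen.1 memvf.
    rewrite -horner_map -map_poly_comp.
    exact: (@subfield_horner _ _ (j \o in_alg L) C).
  have MC : range g `<=` C.
    by rewrite rM; apply: field_generated_min => // x [/LC|].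
  have : ({:M} <= 1)%VS.
    apply/subvP => x _; have : range (g \o in_alg M) (g x).
      by rewrite rK; apply: MC; exists x.
    by move=> [t _ e]; rewrite -(fmorph_inj g e); apply/vlineP; exists t.
  by move/dimvS; rewrite pM.1 dimv1.
have [x] := pure_root_polyS n3K pM yN Ty.
have -> : polyS a' = map_poly idfun (polyS a') by rewrite map_poly_id.
rewrite root_map_polyS /= => /eqP Sx; pose c' := g (in_alg M x).
have Cc' : C c' by rewrite -rK; exists x.
have Ca : C (j (in_alg L a)) by apply: FC; exists a.
have Sc' : c' ^+ 2 + j (in_alg L a) * c' + 1 = 0.
  transitivity ((g \o in_alg M) (x ^+ 2 + a' * x + 1)).
    by rewrite !rmorphD rmorphXn rmorphM rmorph1 -ga.
  by rewrite Sx rmorph0.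
move: Sc; rewrite root_map_polyS /= => /eqP Sc.
have : (c - c') * (c + c' + j (in_alg L a)) = 0.
  transitivity (c ^+ 2 + j (in_alg L a) * c + 1
                - (c' ^+ 2 + j (in_alg L a) * c' + 1)); first by ring.
  by rewrite Sc Sc' subrr.
have [C1 CB _] := (is_subfieldP C).1 sC.
move/eqP; rewrite mulf_eq0 subr_eq0 => /orP[/eqP -> //|/eqP e].
(* The other root -c' - a, written with differences only so that closure under subtraction suffices;
   c' - c' supplies the 0. *)
have -> : c = (c' - c') - c' - j (in_alg L a).
  apply/eqP; rewrite -subr_eq0 -e; apply/eqP; ring.
by do 3![apply: (CB) => //].
Qed.

(** With the root of S already in F, the Möbius image of y is a pure generator inside L itself: were
    it in F, the inverse substitution would put y in F. *)
Lemma purely_cubic_of_root (F : fieldType) (L : fieldExtType F) (a x : F)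
    (y : L) : \dim {:L} = 3%N -> has_generator_minpoly (polyT a) y ->
  root (polyS a) x -> purely_cubic L.
Proof.
move=> degL y_gen Sx; split=> //.
have irrT := polyT_irreducible y_gen; have Ty := generator_root_polyT y_gen.
have Sc : root (map_poly (in_alg L) (polyS a)) (in_alg L x) by rewrite fmorph_root.
have [_ _ c2 /(_ _ Ty) yc] := mobius_facts irrT Sc.
exists ((in_alg L x * y - 1) / (y - in_alg L x)); exists x.
apply: pure_generatorP => //; last by apply/eqP; rewrite (mobius_cube irrT Sc yc).
have [_ yE] := mobius_swap c2 yc erefl.
apply: contra (polyT_root_notin_base irrT Ty) => /vlineP[s us].
apply/vlineP; exists ((x * s - 1) / (s - x)); rewrite yE us -!in_algE.
by rewrite fmorph_div !rmorphB rmorphM rmorph1.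
Qed.

Theorem mainTheorem1
    (F : fieldType) (charF : 3%N \notin [pchar F])
    (L : fieldExtType F) (degL : \dim {:L} = 3%N)
    (a : F) (y : L) (y_gen : has_generator_minpoly (polyT a) y)
    (Fbar : closedFieldType) (j : {rmorphism L -> Fbar})
    (Fbar_alg : forall x : Fbar, algebraicOver (j \o in_alg L) x) :
  (purely_cubic L <-> exists x : F, root (polyS a) x) /\
  forall c : Fbar, root (map_poly (j \o in_alg L) (polyS a)) c ->
    let Fs := range (j \o in_alg L) in
    let Ls := range j in
    is_purely_cubic_closure Fs Ls (adjoin Fs c) /\
    forall (z : L) (u : Fbar),
      [/\ u = (c * j z - 1) / (j z - c),
          purely_cubic_generator_in (adjoin Fs c) (adjoin Ls c) u &
          u ^+ 3 = c]
      <->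
      j z = (c * u - 1) / (u - c) /\ has_generator_minpoly (polyT a) z.
Proof.
have n3 : 3%:R != 0 :> F by move: charF; rewrite inE.
have irrT := polyT_irreducible y_gen.
split.
  split=> [pL|[x Sx]]; last exact: purely_cubic_of_root degL y_gen Sx.
  have Ty := generator_root_polyT y_gen.
  exact: pure_root_polyS n3 pL (polyT_root_notin_base irrT Ty) Ty.
move=> c Sc Fs Ls.
have jT z : root (map_poly (in_alg L) (polyT a)) z ->
    root (map_poly (j \o in_alg L) (polyT a)) (j z).
  by move=> Tz; rewrite map_poly_comp fmorph_root.
have [c0 _ c2 wc] := mobius_facts irrT Sc.
have FL : Fs `<=` Ls by move=> _ [x _ <-]; exists (in_alg L x).
split.
  split; [exact: field_generated_subfield | exact: sub_adjoin | |].
    (* L F(c) = L(c) = F(c)(y), the form in which the Möbius generator is available. *)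
    rewrite (compositum_adjoin _ FL) -(adjoin_range_generator j c y_gen.1).
    apply: (@purely_cubic_generator_in_sub _ _ _ ((c * j y - 1) / (j y - c))).
    exact: purely_cubic_generator_adjoin irrT Sc (jT _ (generator_root_polyT y_gen)).
  move=> C sC FC pC; apply: adjoin_min => //.
  exact: pure_compositum_root n3 y_gen Sc sC FC pC.
move=> z u; split=> [[uE _ u3]|[zE z_gen]].
  (* If j z = c, the quotient defining u is 0 by the convention [0^-1 = 0], and u^3 = c gives c =
     0. *)
  have zc : j z - c != 0.
    apply: contra_neq c0 => e; move: u3; rewrite uE e invr0 mulr0 expr0n.
    by move/esym.
  have [_ zE] := mobius_swap c2 zc uE; split=> //.
  have Tz : root (map_poly (in_alg L) (polyT a)) z.
    rewrite -(fmorph_root j) -map_poly_comp.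
    rewrite -(mobius_cube irrT Sc zc) -uE u3 //.
  apply: cubic_generator => //; rewrite ?polyTE ?monic_cubic ?size_cubic //.
  exact: polyT_root_notin_base irrT Tz.
have Tz := jT _ (generator_root_polyT z_gen).
have zc := wc _ Tz.
(* By the same convention u = c would give j z = 0, so z = 0 would be a root of T in the base
   field. *)
have uc : u - c != 0.
  apply/eqP => e; move: zE; rewrite e invr0 mulr0 => /eqP; rewrite fmorph_eq0 => z0.
  have := polyT_root_notin_base irrT (generator_root_polyT z_gen).
  by rewrite (eqP z0) mem0v.
have [_ uE] := mobius_swap c2 uc zE.
split=> //; last by apply/eqP; rewrite uE (mobius_cube irrT Sc zc).
rewrite -(adjoin_range_generator j c z_gen.1) uE.
exact: purely_cubic_generator_adjoin irrT Sc Tz.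
Qed.
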